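(* A partition $\lambda=[\lambda_1,\lambda_2]$ is a $\mathcal{P}$-position of the game CRIM if and only if $\lambda_1$ is even and $\lambda_2>0$.
   Context: A partition is a finite weakly decreasing sequence $\lambda=[\lambda_1,\ldots,\lambda_r]$ of positive integers, called its parts; the empty partition $[\,]$ is allowed. Thus $\lambda=[\lambda_1,\lambda_2]$ is a two-part partition, with $1\le\lambda_2\le\lambda_1$. The conjugate of $\lambda$ is $\lambda'=[\lambda'_1,\ldots,\lambda'_{\lambda_1}]$, where $\lambda'_k$ is the largest $i$ with $\lambda_i\ge k$. CRIM is the impartial two-player game whose positions are partitions. From $\lambda=[\lambda_1,\ldots,\lambda_r]$, a row move deletes the part $\lambda_i$ for some $1\le i\le r$. A column move takes the conjugate of the partition that results from making a row move on $\lambda'$ (i.e. it removes one column of the Young diagram). Play is normal play: the player to move at the terminal position $[\,]$ loses. A $\mathcal{P}$-position (losing position) is one from which the player who has just moved can force a win. *)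

(* Defs.v *)
From HB Require Import structures.
From mathcomp Require Import all_boot.

Set Implicit Arguments.
Unset Strict Implicit.
Unset Printing Implicit Defensive.

Definition is_partition (s : seq nat) : bool := sorted geq s && (0 \notin s).

Record int_partition := IntPartition {
  parts :> seq nat;
  partsP : is_partition parts
}.

HB.instance Definition _ := [isSub for parts].
HB.instance Definition _ := [Equality of int_partition by <:].

(* The largest 1-based i with s_i >= k; the entries of s are indexed from 0,
   hence the successor. *)
Definition conj_part (s : seq nat) (k : nat) : nat :=
  \max_(i < size s | k <= nth 0 s i) i.+1.

Definition conj_seq (s : seq nat) : seq nat :=
  mkseq (fun k => conj_part s k.+1) (head 0 s).

Lemma conj_partS (s : seq nat) (k : nat) : conj_part s k.+1 <= conj_part s k.
Proof.
apply/bigmax_leqP => i ski.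
apply: (bigmax_sup i) => //; exact: ltnW.
Qed.

Lemma conj_seqP (s : seq nat) : is_partition (conj_seq s).
Proof.
apply/andP; split.
  apply/(sortedP 0) => i; rewrite size_mkseq => lti.
  by rewrite /= !nth_mkseq ?conj_partS //; exact: ltnW.
apply/mapP => -[k]; rewrite mem_iota add0n; case: s => //= x s ltkx.
apply/eqP; rewrite eq_sym -lt0n.
by apply: (@bigmax_sup _ ord0).
Qed.

Definition conjugate (l : int_partition) : int_partition := IntPartition (conj_seqP l).

Definition delete_part (i : nat) (s : seq nat) : seq nat := take i s ++ drop i.+1 s.

Definition row_move (l m : int_partition) : Prop :=
  exists2 i, i < size l & parts m = delete_part i l.

Definition column_move (l m : int_partition) : Prop :=
  exists2 m', row_move (conjugate l) m' & m = conjugate m'.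

Definition crim_move (l m : int_partition) : Prop := row_move l m \/ column_move l m.

(* Forced wins under normal play. The predicates are inductive, so a forced win
   is reached after finitely many moves; a player without a move loses, which
   is the base case of [previous_wins]. *)
Section NormalPlay.

Variables (T : Type) (move : T -> T -> Prop).

Inductive previous_wins (x : T) : Prop :=
  | PreviousWins of (forall y, move x y -> next_wins y)
with next_wins (x : T) : Prop :=
  | NextWins y of move x y & previous_wins y.

End NormalPlay.

Definition crim_P_position (l : int_partition) : Prop := previous_wins crim_move l.

(* Main.v *)
Require Import Defs.
From mathcomp Require Import all_boot.
From mathcomp Require Import zify.

(** A position with at most two rows is determined by its row lengths
    [b <= a].  Its columns are [b] twos followed by [a - b] ones, so a column
    move leads to [(a - 1, b - 1)] or [(a - 1, b)]: it always flips the parity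
    of the first row.  A nonempty single row is won by deleting it, hence row
    moves out of a two-row position lose at once and only the parity of the
    first row matters. *)

Scheme previous_wins_mut := Minimality for previous_wins Sort Prop
  with next_wins_mut := Minimality for next_wins Sort Prop.

(** A forced win is a finite derivation, so mutual induction on it refutes the opposite claim: the
    winning move of one side is a move that the other side has already answered. This turns computed
    outcomes into an equivalence. *)
Lemma previous_wins_not_next (T : Type) (move : T -> T -> Prop) (x : T) :
  previous_wins move x -> ~ next_wins move x.
Proof.
move: x; apply: (@previous_wins_mut T move (fun x => ~ next_wins move x)
  (fun x => ~ previous_wins move x)).
  by move=> x _ IH [y /IH].
by move=> x y xy _ IH [/(_ y xy)].
Qed.

(** In a weakly decreasing sequence the entries at least [k] form a prefix, so the 1-based index of
    the last one is their number. *)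
Lemma conj_part_count (s : seq nat) (k : nat) :
  sorted geq s -> conj_part s k = count (leq k) s.
Proof.
rewrite /conj_part => s_sorted; elim: s s_sorted => [|x s IHs] /=.
  by rewrite big_ord0.
move=> xs_path; have s_sorted := path_sorted xs_path.
rewrite -(big_mkord (fun i => k <= nth 0 (x :: s) i) S) /=.
rewrite big_mkcond big_nat_recl //=.
have geq_trans : transitive geq by move=> ? ? ? /[swap]; apply: leq_trans.
have [le_kx|lt_xk] := leqP k x; last first.
  rewrite max0n add0n big1 => [|i _].
    apply/esym/eqP; rewrite -leqn0 leqNgt -has_count; apply/hasPn => y s_y.
    have /allP /(_ y s_y) /= := order_path_min geq_trans xs_path; lia.
  (* [big1] gives no bound on [i]; past the end the default entry 0 is still below [k], since
     [x < k]. *)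
  case: ifP => // le_ki; have [lt_is|le_si] := ltnP i (size s).
    have /allP /(_ _ (mem_nth 0 lt_is)) /= := order_path_min geq_trans xs_path.
    lia.
  by move: le_ki; rewrite nth_default //; lia.
rewrite -IHs //.
rewrite -(big_mkord (fun i => k <= nth 0 s i) S) -big_mkcond /=.
(* Peeling off the head shifts every index by one; the 1 contributed by the head makes this hold
   even for an empty maximum, which is 0. *)
have maxS (r : seq nat) (P : pred nat) :
    maxn 1 (\max_(i <- r | P i) i.+2) = (\max_(i <- r | P i) i.+1).+1.
  by elim: r => [|i r IHr]; rewrite ?big_nil // !big_cons; case: ifP => _; lia.
by rewrite maxS.
Qed.

(** Filtering out zeros lets one formula cover two rows, one row and the empty position, as a column
    move may exhaust a row. *)
Definition two_rows (a b : nat) : seq nat := [seq x <- [:: a; b] | 0 < x].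

Definition two_cols (m n : nat) : seq nat := nseq m 2 ++ nseq n 1.

Lemma two_colsP (m n : nat) : is_partition (two_cols m n).
Proof.
apply/andP; split; last by rewrite mem_cat !mem_nseq !andbF.
apply/(sortedP 0) => i _ /=; rewrite !nth_cat !size_nseq !nth_nseq.
by do !case: ifP; lia.
Qed.

Lemma conj_two_rows (a b : nat) :
  b <= a -> conj_seq (two_rows a b) = two_cols b (a - b).
Proof.
move=> le_ba; have sorted_ab : sorted geq (two_rows a b).
  by rewrite /two_rows /=; do !case: ifP; rewrite /= ?andbT //; lia.
have head_ab : head 0 (two_rows a b) = a.
  by rewrite /two_rows /=; do !case: ifP => //=; lia.
apply: (@eq_from_nth _ 0) => [|i]; rewrite size_mkseq head_ab.
  by rewrite size_cat !size_nseq subnKC.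
move=> lt_ia; rewrite nth_mkseq ?head_ab // conj_part_count //.
rewrite count_filter /= nth_cat size_nseq !nth_nseq.
by do !case: ifP; lia.
Qed.

Lemma conj_two_cols (m n : nat) :
  conj_seq (two_cols m n) = two_rows (m + n) m.
Proof.
have /andP[sorted_mn _] := two_colsP m n.
rewrite /conj_seq.
have -> : head 0 (two_cols m n) = if 0 < m then 2 else (0 < n).
  by rewrite /two_cols; case: m n {sorted_mn} => [|m] [|n].
have countE k : conj_part (two_cols m n) k = (k <= 2) * m + (k <= 1) * n.
  by rewrite conj_part_count // count_cat !count_nseq.
by case: m n countE {sorted_mn} => [|m] [|n] countE;
  rewrite /two_rows /mkseq /= ?countE ?mul1n ?mul0n ?addn0.
Qed.

(** Parts within a block are equal, so only the block containing [i] matters. *)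
Lemma delete_two_cols (i m n : nat) : i < m + n ->
  delete_part i (two_cols m n) =
    if i < m then two_cols m.-1 n else two_cols m n.-1.
Proof.
move=> lt_i; rewrite /delete_part /two_cols; case: ltnP => [lt_im|le_mi].
  rewrite takel_cat ?size_nseq ?(ltnW lt_im) // drop_cat size_nseq.
  rewrite take_nseq ?(ltnW lt_im) // drop_nseq.
  case: ltnP => [lt|le]; first by rewrite catA -nseqD; do 2 f_equal; lia.
  have -> : i.+1 - m = 0 by lia.
  by rewrite drop0; do 2 f_equal; lia.
rewrite take_cat drop_cat !size_nseq !ltnNge le_mi (leqW le_mi) /=.
rewrite take_nseq ?drop_nseq; last by lia.
by rewrite -catA -nseqD; do 2 f_equal; lia.
Qed.

Lemma column_move_two_rows (l m : int_partition) (a b : nat) :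
  b <= a -> parts l = two_rows a b ->
  column_move l m <->
    0 < b /\ parts m = two_rows a.-1 b.-1 \/
    b < a /\ parts m = two_rows a.-1 b.
Proof.
move=> le_ba l_ab.
have cl : parts (conjugate l) = two_cols b (a - b).
  by rewrite /= l_ab conj_two_rows.
have size_cl : size (conjugate l) = b + (a - b).
  by rewrite cl size_cat !size_nseq.
split=> [[m' [i]]|m_ab].
  rewrite cl size_cat !size_nseq => lt_i m'E ->.
  rewrite /= m'E delete_two_cols //; case: (ltnP i b) => [lt_ib|le_bi].
    by left; rewrite conj_two_cols; split; [|f_equal]; lia.
  by right; rewrite conj_two_cols; split; [|f_equal]; lia.
case: m_ab => [[b_gt0 mE]|[lt_ba mE]].
  exists (IntPartition (two_colsP b.-1 (a - b))).
    exists 0; first by rewrite size_cl; lia.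
    by rewrite cl delete_two_cols ?b_gt0 //; lia.
  by apply: val_inj; rewrite /= conj_two_cols mE; f_equal; lia.
exists (IntPartition (two_colsP b (a - b).-1)).
  (* Index [b] is the first part equal to 1, just after the [b] twos. *)
  exists b; first by rewrite size_cl; lia.
  by rewrite cl delete_two_cols ?ltnn //; lia.
by apply: val_inj; rewrite /= conj_two_cols mE; f_equal; lia.
Qed.

Lemma two_rowsP (a b : nat) : b <= a -> is_partition (two_rows a b).
Proof.
move=> le_ba; rewrite /is_partition mem_filter ltnn andbT /two_rows /=.
by do !case: ifP; rewrite /= ?andbT //; lia.
Qed.

Lemma empty_previous_wins (l : int_partition) :
  parts l = [::] -> previous_wins crim_move l.
Proof. by move=> lE; constructor=> y [[i]|[m' [i]]] //=; rewrite lE. Qed.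

Lemma single_row_next_wins (l : int_partition) (a : nat) :
  parts l = [:: a] -> next_wins crim_move l.
Proof.
move=> lE; pose e := IntPartition (isT : is_partition [::]).
apply: (@NextWins _ _ _ e); last exact: empty_previous_wins.
by left; exists 0; rewrite lE.
Qed.

(** Each column move lowers the first row by exactly one, hence induction on [a] with [b] free; the
    two outcomes are proved together because each rests on the other. *)
Lemma two_rows_outcome (l : int_partition) (a b : nat) :
  0 < b <= a -> parts l = [:: a; b] ->
  if odd a then next_wins crim_move l else previous_wins crim_move l.
Proof.
elim: a l b => [|a IHa] l b /andP[b_gt0 le_ba] lE; first by lia.
have two_rowsE c d : 0 < d <= c -> two_rows c d = [:: c; d].
  by case/andP=> d_gt0 le_dc; rewrite /two_rows /= d_gt0 (leq_trans d_gt0).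
have l_ab : parts l = two_rows a.+1 b by rewrite two_rowsE ?b_gt0.
have colP m := column_move_two_rows l m a.+1 b le_ba l_ab.
rewrite /=; case: ifP => [even_a|odd_a].
  (* Here the first row [a.+1] is odd. If [a = 0] the position is a single column, and removing it
     ends the game. *)
  case: (posnP a) => [a0|a_gt0].
    pose e := IntPartition (isT : is_partition [::]).
    have b1 : b = 1 by lia.
    apply: (@NextWins _ _ _ e); last exact: empty_previous_wins.
    by right; apply/colP; left; rewrite a0 b1.
  (* The winning column must leave the second row nonempty: height two if [b > 1], otherwise height
     one, available because [b = 1 <= a]. *)
  case: (ltnP 1 b) => [b_gt1|b_le1].
    have le_b'a : b.-1 <= a by lia.
    pose m := IntPartition (two_rowsP a b.-1 le_b'a).
    apply: (@NextWins _ _ _ m); first by right; apply/colP; left.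
    have := IHa m b.-1; rewrite (negPf even_a); apply; first by lia.
    by rewrite /m /= -two_rowsE //; lia.
  have le_ba' : b <= a by lia.
  pose m := IntPartition (two_rowsP a b le_ba').
  apply: (@NextWins _ _ _ m); first by right; apply/colP; right.
  have := IHa m b; rewrite (negPf even_a); apply; first by lia.
  by rewrite /m /= -two_rowsE //; lia.
have {}odd_a : odd a by rewrite -[odd a]negbK odd_a.
have a_gt0 : 0 < a by case: (a) odd_a.
constructor=> y [[i]|/colP[[_ yE]|[lt_ba yE]]].
- rewrite lE; case: i => [|[|i]] //= _; apply: single_row_next_wins.
(* If [b = 1], this move exhausts the second row and the opponent deletes the remaining one. *)
- case: (ltnP 1 b) => [b_gt1|b_le1].
    have := IHa y b.-1; rewrite odd_a; apply; first by lia.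
    by rewrite yE two_rowsE //; lia.
  apply: (single_row_next_wins y a); rewrite yE /= /two_rows /= a_gt0.
  by have -> : b.-1 = 0 by lia.
have := IHa y b; rewrite odd_a; apply; first by lia.
by rewrite yE two_rowsE //; lia.
Qed.

Theorem proposition10 (l : int_partition) (l1 l2 : nat) :
  parts l = [:: l1; l2] ->
  crim_P_position l <-> (~~ odd l1 /\ 0 < l2).
Proof.
move=> lE; have := partsP l; rewrite lE /is_partition !inE /= andbT => l12.
have l12_bounds : 0 < l2 <= l1 by lia.
have := two_rows_outcome l l1 l2 l12_bounds lE; case: odd => [nw|pw].
  by split=> [pw|[] //]; case: (previous_wins_not_next _ _ _ pw nw).
by split=> // _; case/andP: l12_bounds.
Qed.
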